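(* Let $(\mathbb{X},\mathcal{X},\mu)$ be a probability space and let $\lambda\in[2,\infty)$. Let $\tilde M$ be the set of finite measures $P$ on $\mathcal{X}$ that are mutually absolutely continuous with respect to $\mu$ and whose density $p=dP/d\mu$ satisfies $\mathbf{E}_\mu p^\lambda<\infty$ and $\mathbf{E}_\mu|\log p|^\lambda<\infty$. Let $\tilde G=L^\lambda(\mu)$, and define $\tilde\phi:\tilde M\to\tilde G$ by $$\tilde\phi(P)=p-1+\log p .$$ Then $\tilde\phi$ is a bijection onto $\tilde G$.
   Context: $\mathbf{E}_\mu$ denotes expectation (integration) with respect to $\mu$. $L^\lambda(\mu)$ is the usual Lebesgue space of ($\mu$-a.e. equivalence classes of) real-valued measurable functions $\tilde a:\mathbb{X}\to\mathbb{R}$ with $\mathbf{E}_\mu|\tilde a|^\lambda<\infty$. *)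

(* Defs.v *)
From HB Require Import structures.
From mathcomp Require Import all_boot all_order all_algebra.
From mathcomp Require Import all_classical all_reals all_analysis.
From mathcomp Require Import measurable_realfun.

Set Implicit Arguments.
Unset Strict Implicit.
Unset Printing Implicit Defensive.

Import Order.TTheory GRing.Theory Num.Theory.
Import numFieldNormedType.Exports.

Local Open Scope classical_set_scope.
Local Open Scope ring_scope.
Local Open Scope charge_scope.
Local Open Scope quotient_scope.

(* A library measure is a function on all of [set T], its values outside the
   sigma-algebra being unspecified.  A finite measure on the sigma-algebra is
   therefore a class of library measures that agree on measurable sets. *)
Section FiniteMeasureOn.
Context {d : measure_display} (T : measurableType d) (R : realType).

HB.instance Definition _ := gen_eqMixin {finite_measure set T -> \bar R}.
HB.instance Definition _ := gen_choiceMixin {finite_measure set T -> \bar R}.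

Definition measure_eq_op (P Q : {finite_measure set T -> \bar R}) : bool :=
  `[< forall A, measurable A -> P A = Q A >].

Let measure_eq_op_refl : reflexive measure_eq_op.
Proof. by move=> P; apply/asboolP. Qed.

Let measure_eq_op_sym : symmetric measure_eq_op.
Proof.
by move=> P Q; apply/idP/idP => /asboolP h; apply/asboolP => A mA; rewrite h.
Qed.

Let measure_eq_op_trans : transitive measure_eq_op.
Proof.
move=> P Q S /asboolP h1 /asboolP h2; apply/asboolP => A mA.
by rewrite h1// h2.
Qed.

Canonical measure_eq_op_canonical :=
  EquivRel measure_eq_op measure_eq_op_refl measure_eq_op_sym
    measure_eq_op_trans.

Definition finMeasure : Type := {eq_quot measure_eq_op}.
HB.instance Definition _ := Choice.on finMeasure.
HB.instance Definition _ := EqQuotient.on finMeasure.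

End FiniteMeasureOn.

Section Model.
Context {d : measure_display} {T : measurableType d} {R : realType}.
Variable mu : probability T R.

(* If [P `<< mu], the derivative is finite everywhere, so [fine] loses nothing. *)
Definition rnDensity (P : {finite_measure set T -> \bar R}) : T -> R :=
  fun x => fine (('d (charge_of_finite_measure P) '/d mu) x).

Definition density (P : finMeasure T R) : T -> R := rnDensity (repr P).

(* [density] does not depend on the chosen representative. *)
Lemma density_pi (P : {finite_measure set T -> \bar R}) : P `<< mu ->
  repr (\pi_(finMeasure T R) P) `<< mu /\
  ae_eq mu setT (density (\pi_(finMeasure T R) P)) (rnDensity P).
Proof.
move=> Pmu; set Q := repr _.
have QP A : measurable A -> Q A = P A.
  have : Q = P %[mod finMeasure T R] by rewrite /Q reprK.
  by move=> /eqmodP/asboolP; apply.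
have Qmu : Q `<< mu.
  apply/null_content_dominatesP => A mA A0; rewrite QP//.
  by move/null_content_dominatesP : Pmu; apply.
split=> //.
suff : ae_eq mu setT ('d (charge_of_finite_measure Q) '/d mu)
                     ('d (charge_of_finite_measure P) '/d mu).
  by apply: filterS => x /(_ I); rewrite /density /rnDensity -/Q => ->.
apply: integral_ae_eq => //.
- exact: Radon_Nikodym_integrable.
- by move=> A _ mA; rewrite -!Radon_Nikodym_integral//; exact: QP.
Qed.

(* [ln] is [0] on nonpositive reals; as [mu `<< repr P], the density is
   positive [mu]-almost everywhere. *)
Definition Mtilde (lam : R) : set (finMeasure T R) :=
  [set P : finMeasure T R | [/\ repr P `<< mu, mu `<< repr P,
    ('E_mu[fun x => (density P x `^ lam)%R] < +oo)%E &
    ('E_mu[fun x => (`|ln (density P x)| `^ lam)%R] < +oo)%E]].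

Definition phi_fun (P : finMeasure T R) : T -> R :=
  fun x => density P x - 1 + ln (density P x).

Lemma measurable_density (P : finMeasure T R) : measurable_fun setT (density P).
Proof.
suff mf : measurable_fun setT
    ('d (charge_of_finite_measure (repr P)) '/d mu : T -> \bar R).
  exact: measurableT_comp (fine_measurable measurableT) mf.
rewrite /Radon_Nikodym; case: pselect => [h|h]; last exact: measurable_cst.
by case: cid => f /= [_ /integrableP[]].
Qed.

Lemma measurable_ln_density (P : finMeasure T R) :
  measurable_fun setT (fun x => ln (density P x)).
Proof.
by apply: measurableT_comp; [exact: measurable_ln|exact: measurable_density].
Qed.

Lemma measurable_phi_fun (P : finMeasure T R) : measurable_fun setT (phi_fun P).
Proof.
apply: measurable_funD; last exact: measurable_ln_density.
exact/measurable_funB/measurable_cst/measurable_density.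
Qed.

Definition phi_mfun (P : finMeasure T R) : {mfun T >-> measurableTypeR R} :=
  MeasurableFun.Pack (MeasurableFun.Class
    (isMeasurableFun.Build _ _ _ (measurableTypeR R) _ (measurable_phi_fun P))).

Definition phi_class (P : finMeasure T R) :
    {mfun_ mu, T >-> measurableTypeR R} :=
  \pi_({mfun_ mu, T >-> measurableTypeR R}) (phi_mfun P).

Lemma density_ge0 (P : finMeasure T R) : repr P `<< mu ->
  {ae mu, forall x, 0 <= density P x}.
Proof.
move=> Pmu; have := ae_eq_Radon_Nikodym_SigmaFinite Pmu measurableT.
apply: filterS => x /(_ I) fE; rewrite /density /rnDensity -fE fine_ge0//.
exact: Radon_Nikodym_SigmaFinite.f_ge0.
Qed.

Lemma Lfun_density (lam : R) (P : finMeasure T R) :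
  0 < lam -> Mtilde lam P -> density P \in Lfun mu lam%:E.
Proof.
move=> lam0 [Pmu _ plam _]; apply/andP; split; rewrite inE/=.
  exact: measurable_density.
rewrite /finite_norm unlock poweR_lty//.
move: plam; rewrite unlock; apply: le_lt_trans; rewrite le_eqVlt.
apply/orP; left; apply/eqP/ae_eq_integral => //.
- apply/measurable_EFinP/(measurableT_comp (measurable_powR _))/measurableT_comp => //.
  exact: measurable_density.
- exact/measurable_EFinP/(measurableT_comp (measurable_powR _))/measurable_density.
- by apply: filterS (density_ge0 Pmu) => x p0 _ /=; rewrite ger0_norm.
Qed.

Lemma Lfun_ln_density (lam : R) (P : finMeasure T R) :
  Mtilde lam P -> (fun x => ln (density P x)) \in Lfun mu lam%:E.
Proof.
move=> [_ _ _ plam]; apply/andP; split; rewrite inE/=.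
  exact: measurable_ln_density.
by rewrite /finite_norm unlock poweR_lty//; move: plam; rewrite unlock.
Qed.

Lemma finite_norm_phi (lam : R) (P : finMeasure T R) :
  (1 <= lam%:E)%E -> Mtilde lam P -> finite_norm mu lam%:E (phi_class P).
Proof.
move=> lam1 MP.
have lam0 : 0 < lam by rewrite (lt_le_trans ltr01)// -lee_fin.
have LD (f g : T -> R) : f \in Lfun mu lam%:E -> g \in Lfun mu lam%:E ->
    f \+ g \in Lfun mu lam%:E by exact: (Lfun_addr_closed mu lam1).2.
have : phi_fun P \in Lfun mu lam%:E.
  apply: (LD (fun x => density P x - 1)); last exact: Lfun_ln_density.
  apply: (LD (density P) (cst (- 1))); first exact: Lfun_density.
  exact: Lfun_cst.
move=> /andP[_]; rewrite inE/= /finite_norm !unlock => plam.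
suff -> : (\int[mu]_x (`|(EFin \o phi_class P) x| `^ lam) =
  \int[mu]_x (`|(EFin \o phi_fun P) x| `^ lam))%E by [].
have mphi : measurable_fun setT (phi_class P : T -> R).
  exact: (@measurable_funPT _ _ _ _ (repr (phi_class P))).
apply: ae_eq_integral => //.
- apply/measurable_EFinP/(measurableT_comp (measurable_powR _))/measurableT_comp => //.
- apply/measurable_EFinP/(measurableT_comp (measurable_powR _))/measurableT_comp => //.
  exact: measurable_phi_fun.
have : repr (phi_class P) = phi_mfun P
  %[mod {mfun_ mu, T >-> measurableTypeR R}] by rewrite reprK.
move=> /eqmodP/asboolP; apply: filterS => x h _ /=.
by rewrite /aqEqMfun_to_fun (h I).
Qed.

Definition phitilde (lam : R) (lam1 : (1 <= lam%:E)%E) (P : Mtilde lam) :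
    LspaceType mu lam1 :=
  HB.pack (phi_class (val P))
    (isFinLebesgue.Build d T R mu lam%:E lam1 (phi_class (val P))
       (finite_norm_phi lam1 (set_valP P))).

End Model.

(* [LspaceType] is indexed by a proof that the exponent is at least [1]. *)
Lemma ge2_ge1 (R : realType) (lam : R) : 2 <= lam -> (1 <= lam%:E)%E.
Proof. by move=> h; rewrite lee_fin (le_trans _ h)// ler1n. Qed.

(* Main.v *)
Require Import Defs.
From mathcomp Require Import all_boot all_order all_algebra.
From mathcomp Require Import all_classical all_reals all_analysis.
From HB Require Import structures.
From mathcomp Require Import measurable_realfun lra.

Set Implicit Arguments.
Unset Strict Implicit.
Unset Printing Implicit Defensive.

(** The map acts pointwise on densities through [y - 1 + ln y].  Substituting
    [y = expR t] turns this into [expm1_add t = expR t - 1 + t], a continuous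
    strictly increasing function which is at least [t] for [t >= 0] and at most
    [t] for [t <= 0], hence a bijection of the real line
    ([expm1_add_inj], [expm1_add_surj]).

    Injectivity: a measure in the domain has an almost everywhere positive
    density, because it has the same null sets as [mu] ([density_gt0]).  Equal
    images therefore have almost everywhere equal densities
    ([subr1_addln_inj]), and a measure absolutely continuous with respect to
    [mu] is determined by its density ([finMeasure_eq_density]).

    Surjectivity: given [a] in the Lebesgue space, the only candidate density is
    [p = expR t] with [expm1_add t = a].  What makes it admissible is that
    [expR t - 1] and [t] always have the same sign, so that
    [`|a| = `|p - 1| + `|ln p|] ([normr_expm1_add]): both [p - 1] and [ln p]
    are dominated by [a] and inherit its integrability.  Measurability of [p]
    comes from the monotonicity of the inverse of [expm1_add], and its strict
    positivity makes the measure with density [p] equivalent to [mu]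
    ([exists_phi_fun]). *)

Import Order.TTheory GRing.Theory Num.Theory.
Import numFieldNormedType.Exports.

Local Open Scope classical_set_scope.
Local Open Scope ring_scope.

(** * The real function behind the chart *)

Section ExpChart.
Context {R : realType}.
Implicit Types x t : R.

Definition expm1_add t : R := expR t - 1 + t.

Lemma expm1_add_lt : {homo expm1_add : s t / s < t}.
Proof. by move=> s t st; rewrite /expm1_add ltrD// ltrD2r ltr_expR. Qed.

Lemma expm1_add_inj : injective expm1_add.
Proof. exact: inc_inj (le_mono expm1_add_lt). Qed.

(** The two summands have the same sign, so there is no cancellation.  This is
    the source of every integrability bound below. *)
Lemma normr_expm1_add t : `|expm1_add t| = `|expR t - 1| + `|t|.
Proof.
rewrite /expm1_add; have [t0|t0] := leP 0 t.
- have e1 : 0 <= expR t - 1 by rewrite subr_ge0 -expR0 ler_expR.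
  by rewrite (ger0_norm t0) (ger0_norm e1) ger0_norm// addr_ge0.
- have e1 : expR t - 1 < 0 by rewrite subr_lt0 -expR0 ltr_expR.
  rewrite (ltr0_norm t0) (ltr0_norm e1) -opprD ltr0_norm//.
  by rewrite -oppr_gt0 opprD addr_gt0 ?oppr_gt0.
Qed.

Lemma expm1_add_surj x : exists t, expm1_add t = x.
Proof.
(* As [expm1_add] moves every point away from its zero [0], its values at
   [- `|x|] and [`|x|] bracket [x]. *)
have kc : {within `[- `|x|, `|x|], continuous expm1_add}.
  apply: continuous_subspaceT => t; apply: cvgD; last exact: cvg_id.
  by apply: cvgB; [exact: continuous_expR|exact: cvg_cst].
have x0 := normr_ge0 x.
have hi : `|x| <= expm1_add `|x|.
  by rewrite /expm1_add lerDr subr_ge0 -expR0 ler_expR.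
have lo : expm1_add (- `|x|) <= - `|x|.
  by rewrite /expm1_add gerDr subr_le0 -expR0 ler_expR oppr_le0.
have [||t _ tx] := IVT _ kc (v := x); [lra| |by exists t].
rewrite ge_min le_max; apply/andP; split; apply/orP; [left|right].
  by apply: le_trans lo _; rewrite lerNl ler_normr lexx orbT.
by apply: le_trans hi; exact: ler_norm.
Qed.

Definition expm1_add_inv x : R := sval (cid (expm1_add_surj x)).

Lemma expm1_add_invK : cancel expm1_add_inv expm1_add.
Proof. by move=> x; rewrite /expm1_add_inv; case: cid. Qed.

(** Monotonicity is what gives measurability of the inverse. *)
Lemma expm1_add_inv_homo : {homo expm1_add_inv : x y / x <= y}.
Proof.
by move=> x y xy; rewrite -(le_mono expm1_add_lt) !expm1_add_invK.
Qed.

Lemma normr_expm1_add_inv x : `|expm1_add_inv x| <= `|x|.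
Proof. by rewrite -{2}(expm1_add_invK x) normr_expm1_add lerDr. Qed.

Lemma normr_expR_expm1_add_inv x : `|expR (expm1_add_inv x) - 1| <= `|x|.
Proof. by rewrite -{2}(expm1_add_invK x) normr_expm1_add lerDl. Qed.

Lemma subr1_addln_inj x y : 0 < x -> 0 < y ->
  x - 1 + ln x = y - 1 + ln y -> x = y.
Proof.
move=> x0 y0 xy; apply: ln_inj; rewrite ?posrE//; apply: expm1_add_inj.
by rewrite /expm1_add !lnK.
Qed.

End ExpChart.

(** * Domination in Lebesgue spaces *)

Section Lfun_facts.
Context {d : measure_display} {T : measurableType d} {R : realType}.
Variables (mu : {measure set T -> \bar R}) (lam : R).
Hypothesis lam1 : 1 <= lam.

Lemma Lfun_le (f g : T -> R) : measurable_fun setT f ->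
  (forall x, `|f x| <= `|g x|) -> g \in Lfun mu lam%:E -> f \in Lfun mu lam%:E.
Proof.
move=> mf fg gL; have lam0 : 0 <= lam by exact: le_trans lam1.
apply/andP; split; rewrite inE//= /finite_norm unlock poweR_lty//.
have /integrableP[mg glt] := Lfun_integrable lam1 gL.
apply: le_lt_trans glt; apply: ge0_le_integral => //.
- by move=> x _; exact: poweR_ge0.
- apply/measurable_EFinP/(measurableT_comp (measurable_powR _)).
  exact: measurableT_comp.
- exact: measurableT_comp mg.
- move=> x _ /=; rewrite lee_fin [leRHS]ger0_norm ?powR_ge0//.
  by rewrite ge0_ler_powR// nnegrE.
Qed.

End Lfun_facts.

(** * Finite measures and their densities *)

Section DensityMeasure.
Context {d : measure_display} {T : measurableType d} {R : realType}.
Variable mu : probability T R.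
Local Open Scope charge_scope.

Lemma exists_measure_of_density (p : T -> R) : (forall x, 0 <= p x) ->
  mu.-integrable setT (EFin \o p) ->
  exists P : {finite_measure set T -> \bar R},
    forall A, measurable A -> P A = (\int[mu]_(x in A) (p x)%:E)%E.
Proof.
move=> p0 ip.
pose m A := (\int[mu]_(x in A) (p x)%:E)%E.
have m0 : m set0 = 0%E by rewrite /m integral_set0.
have mge0 A : (0 <= m A)%E by apply: integral_ge0 => x _; rewrite lee_fin.
have msa : semi_sigma_additive m.
  apply: semi_sigma_additive_nng_induced => [|x]; last by rewrite lee_fin.
  exact: measurable_int ip.
have mfin : fin_num_fun m.
  move=> A mA; apply: integrable_fin_num => //; exact: integrableS ip.
pose M : {measure set T -> \bar R} :=
  HB.pack m (isMeasure.Build _ _ _ m m0 mge0 msa).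
pose P : {finite_measure set T -> \bar R} :=
  HB.pack m M (Measure_isFinite.Build _ _ _ M mfin).
by exists P.
Qed.

(** Uniqueness of the Radon-Nikodym derivative. *)
Lemma rnDensity_ae_eq (P : {finite_measure set T -> \bar R}) (p : T -> R) :
  mu.-integrable setT (EFin \o p) ->
  (forall A, measurable A -> P A = \int[mu]_(x in A) (p x)%:E)%E ->
  P `<< mu /\ ae_eq mu setT (rnDensity mu P) p.
Proof.
move=> ip PE.
have Pmu : P `<< mu.
  apply/null_content_dominatesP => A mA A0; rewrite PE//.
  apply: null_set_integral => //; apply: measurable_funTS.
  exact: measurable_int ip.
split=> //.
suff : ae_eq mu setT ('d (charge_of_finite_measure P) '/d mu) (EFin \o p).
  by apply: filterS => x /(_ I); rewrite /rnDensity => ->.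
apply: integral_ae_eq => //.
- exact: Radon_Nikodym_integrable.
- exact: measurable_int ip.
- by move=> A _ mA; rewrite -Radon_Nikodym_integral//; exact: PE.
Qed.

Lemma density_EFin (P : finMeasure T R) : repr P `<< mu ->
  EFin \o density mu P = 'd (charge_of_finite_measure (repr P)) '/d mu.
Proof.
by move=> Pmu; apply/funext => x; rewrite /= fineK// Radon_Nikodym_fin_num.
Qed.

Lemma integral_density (P : finMeasure T R) A : repr P `<< mu ->
  measurable A -> repr P A = (\int[mu]_(x in A) (density mu P x)%:E)%E.
Proof.
move=> Pmu mA.
rewrite -[LHS]/(charge_of_finite_measure (repr P) A).
by rewrite (@Radon_Nikodym_integral _ _ _ _ mu)// -density_EFin.
Qed.

(** The set where the density is nonpositive has [P]-measure at most [0], so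
    it is [P]-null and, by the reverse absolute continuity, [mu]-null. *)
Lemma density_gt0 (P : finMeasure T R) : repr P `<< mu -> mu `<< repr P ->
  {ae mu, forall x, 0 < density mu P x}.
Proof.
move=> Pmu /null_content_dominatesP muP.
pose A := (density mu P @^-1` [set y | y <= 0]).
have mA : measurable A.
  rewrite -[A]setTI; apply: (measurable_density mu P) => //.
  have -> : [set y : R | y <= 0] = `]-oo, 0]%classic.
    by apply/seteqP; split => y /=; rewrite in_itv.
  exact: measurable_itv.
have PA0 : repr P A = 0%E.
  apply/eqP; rewrite eq_le measure_ge0 andbT integral_density//.
  rewrite -(integral0 mu A); apply: le_integral => //.
  - apply: (integrableS measurableT) => //.
    by rewrite [X in _.-integrable _ X](density_EFin Pmu);
      exact: Radon_Nikodym_integrable.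
  - exact: integrable0.
  - by move=> x; rewrite inE /A/= lee_fin.
exists A; split => //; first exact: muP.
by move=> x /= /negP; rewrite -leNgt.
Qed.

Lemma finMeasure_eq_density (P Q : finMeasure T R) :
  repr P `<< mu -> repr Q `<< mu ->
  ae_eq mu setT (density mu P) (density mu Q) -> P = Q.
Proof.
move=> Pmu Qmu PQ.
rewrite -(reprK P) -(reprK Q); apply/eqmodP/asboolP => A mA.
rewrite !integral_density//; apply: ae_eq_integral => //.
- exact/measurable_EFinP/measurable_funTS/measurable_density.
- exact/measurable_EFinP/measurable_funTS/measurable_density.
- by apply: filterS PQ => x /(_ I) /= ->.
Qed.

End DensityMeasure.

(** * The bijection *)

(** The density is [expR t] where [t] solves [expR t - 1 + t = a]. *)
Lemma exists_phi_fun (d : measure_display) (X : measurableType d) (R : realType)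
    (mu : probability X R) (lam : R) (a : X -> R) :
  1 <= lam -> measurable_fun setT a -> a \in Lfun mu lam%:E ->
  exists P : finMeasure X R,
    Mtilde mu lam P /\ ae_eq mu setT (phi_fun mu P) a.
Proof.
move=> lam1 ma aL.
have lam1E : (1 <= lam%:E)%E by rewrite lee_fin.
pose t x := expm1_add_inv (a x); pose p x := expR (t x).
have mt : measurable_fun setT t.
  apply: (measurableT_comp (nondecreasing_measurable _ _) ma) => //.
  exact: expm1_add_inv_homo.
have mp : measurable_fun setT p by exact: measurableT_comp mt.
have tL : t \in Lfun mu lam%:E.
  by apply: (Lfun_le lam1 mt _ aL) => x; exact: normr_expm1_add_inv.
have p1L : (fun x => p x - 1) \in Lfun mu lam%:E.
  apply: (Lfun_le lam1 _ _ aL) => [|x]; last exact: normr_expR_expm1_add_inv.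
  exact: measurable_funB.
have pL : p \in Lfun mu lam%:E.
  (* Constants belong to the Lebesgue space because [mu] is finite. *)
  have -> : p = (fun x => p x - 1) + cst 1.
    by apply/funext => x; rewrite /GRing.add/= subrK.
  apply: (Lfun_addr_closed mu lam1E).2 => //; exact: Lfun_cst.
have p0 x : 0 < p x by exact: expR_gt0.
have ip : mu.-integrable setT (EFin \o p).
  apply/Lfun1_integrable; apply: (Lfun_subset _ _ _ _ pL) => //.
  exact: fin_num_measure.
have [P PE] := exists_measure_of_density (fun x => ltW (p0 x)) ip.
have [Pmu Pp] := rnDensity_ae_eq ip PE.
have [Qmu QP] := density_pi Pmu.
pose Q : finMeasure X R := (\pi_(finMeasure X R) P)%qT.
have Qp : ae_eq mu setT (density mu Q) p := ae_eq_trans QP Pp.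
have QE A : measurable A -> repr Q A = (\int[mu]_(x in A) (p x)%:E)%E.
  move=> mA; rewrite (integral_density Qmu)//; apply: ae_eq_integral => //.
  - exact/measurable_EFinP/measurable_funTS/measurable_density.
  - exact/measurable_EFinP/measurable_funTS.
  - by apply: filterS Qp => x /(_ I) /= ->.
exists Q; split; last first.
  apply: filterS Qp => x /(_ I) Qpx _; rewrite /phi_fun Qpx expRK.
  exact: expm1_add_invK.
split => //.
- apply/null_content_dominatesP => A mA QA0.
  have A0 : (\int[mu]_(x in A) (p x)%:E = 0)%E by rewrite -(QE _ mA).
  (* A strictly positive function with null integral over [A] vanishes almost
     everywhere on [A], which leaves no room for [A]. *)
  have : ae_eq mu A (EFin \o p) (cst 0%E).
    apply/ae_eq_integral_abs => //.
      exact/measurable_funTS/measurable_int/ip.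
    by rewrite -[RHS]A0; apply: eq_integral => x _; rewrite /= ger0_norm// ltW.
  move=> pA0; apply/measure_negligible => //; apply: negligibleS pA0.
  by move=> x Ax /= /(_ Ax)[] /eqP; rewrite gt_eqF.
- rewrite unlock; have /integrableP[mpow] := Lfun_integrable lam1 pL.
  apply: le_lt_trans; rewrite le_eqVlt; apply/orP; left; apply/eqP.
  apply: ae_eq_integral => //.
  + apply/measurable_EFinP/(measurableT_comp (measurable_powR _)).
    exact: measurable_density.
  + exact: measurableT_comp mpow.
  + apply: filterS Qp => x /(_ I) /= -> _.
    by rewrite ger0_norm ?powR_ge0// ger0_norm// ltW.
- rewrite unlock; have /integrableP[mpow] := Lfun_integrable lam1 tL.
  apply: le_lt_trans; rewrite le_eqVlt; apply/orP; left; apply/eqP.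
  apply: ae_eq_integral => //.
  + apply/measurable_EFinP/(measurableT_comp (measurable_powR _)).
    apply: measurableT_comp => //; exact: measurable_ln_density.
  + exact: measurableT_comp mpow.
  + apply: filterS Qp => x /(_ I) /= -> _.
    by rewrite expRK [in RHS]ger0_norm ?powR_ge0.
Qed.

(** The membership proof carried by an element is irrelevant, so equality can
    be tested on the underlying almost-everywhere classes. *)
Lemma LspaceType_inj (d : measure_display) (X : measurableType d)
    (R : realType) (mu : {measure set X -> \bar R}) (p : \bar R)
    (p1 : (1 <= p)%E) (f g : LspaceType mu p1) :
  f = g :> {mfun_ mu, X >-> measurableTypeR R} -> f = g.
Proof.
case: f g => [f [[cf]]] [g [[cg]]] /= e.
by move: cf; rewrite e => cf; do 3 f_equal; exact: Prop_irrelevance.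
Qed.

Theorem proposition3p1 (d : measure_display) (X : measurableType d)
    (R : realType) (mu : probability X R) (lam : R) (lam2 : 2 <= lam) :
  bijective (phitilde (ge2_ge1 lam2) :
    Mtilde mu lam -> LspaceType mu (ge2_ge1 lam2)).
Proof.
have lam1 : 1 <= lam by rewrite (le_trans _ lam2)// ler1n.
rewrite -setTT_bijective; split => //.
- move=> P Q _ _ PQ; apply: val_inj; set lam1' := ge2_ge1 lam2 in PQ.
  have [[Pmu muP _ _] [Qmu muQ _ _]] := (set_valP P, set_valP Q).
  apply: (finMeasure_eq_density Pmu Qmu).
  have : phi_class mu (val P) = phi_class mu (val Q).
    exact: (congr1 (fun F : LspaceType mu lam1' =>
      (F : {mfun_ mu, X >-> measurableTypeR R})) PQ).
  move=> /eqmodP/asboolP phiPQ.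
  have := density_gt0 Qmu muQ; have := density_gt0 Pmu muP.
  apply: filterS3 phiPQ => x /(_ I) /= xPQ Px Qx _.
  exact: subr1_addln_inj xPQ.
- move=> F _.
  pose a0 := repr (F : {mfun_ mu, X >-> measurableTypeR R}).
  pose a : X -> R := a0.
  have ma : measurable_fun setT a by exact: (@measurable_funPT _ _ _ _ a0).
  have aL : a \in Lfun mu lam%:E.
    apply/andP; split; rewrite inE//.
    exact: (@Lebesgue_finite _ _ _ _ _ _ F).
  have [P [MP aP]] := exists_phi_fun lam1 ma aL.
  exists (exist _ P (mem_set MP)) => //; apply: LspaceType_inj => /=.
  rewrite -[RHS]reprK; apply/eqmodP/asboolP.
  exact: aP.
Qed.
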